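(* Let $\Omega\subset\mathbb{R}^2$ be open, $\lambda>0$, and let $u\in L^2(\Omega)$ satisfy $-\Delta u=\lambda u$ in $\Omega$. Let $\mathbf{x}_0\in\Omega$, $h>0$, and let $\mathbf{e}^-,\mathbf{e}^+$ be unit vectors with angle $\alpha\pi$ from $\mathbf{e}^-$ to $\mathbf{e}^+$, where $\alpha\in(0,2)$ is irrational; put $\Gamma^\pm=\{\mathbf{x}_0+t\mathbf{e}^\pm:0\le t\le h\}\subset\Omega$. Suppose $\Gamma^-$ is a generalized singular line of $u$ with constant parameter $\eta_1\equiv C_1$ and $\Gamma^+$ is a nodal line of $u$ ($u=0$ on $\Gamma^+$). Then $\mathrm{Vani}(u;\mathbf{x}_0)=+\infty$.
   Context: No boundary condition is imposed on $\partial\Omega$; $u$ is real-analytic in $\Omega$. A generalized singular line with parameter $\eta$ (not identically zero; here a nonzero complex constant) is a segment $\Gamma$ on which $\partial_\nu u+\eta u=0$, $\nu$ a unit normal to $\Gamma$. $\mathrm{Vani}(u;\mathbf{x}_0)$ is the smallest degree of a nonzero homogeneous term in the Taylor expansion of $u$ at $\mathbf{x}_0$ ($+\infty$ if all vanish). *)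

(* Defs.v *)
From HB Require Import structures.
From mathcomp Require Import all_boot all_order all_algebra.
From mathcomp Require Import all_classical all_reals all_analysis.
Import Order.TTheory GRing.Theory Num.Theory.
Import numFieldNormedType.Exports.
Local Open Scope classical_set_scope.
Local Open Scope ring_scope.

(* Points of R^2 are pairs (x1, x2) : R * R.
   Complex numbers are represented as pairs (Re, Im) : R * R, so a complex
   valued function u on R^2 is  u : R * R -> R * R. *)

Definition cmul {R : realType} (a b : R * R) : R * R :=
  (a.1 * b.1 - a.2 * b.2, a.1 * b.2 + a.2 * b.1).

Definition cabs2 {R : realType} (z : R * R) : R := z.1 ^+ 2 + z.2 ^+ 2.

Definition dx1 {R : realType} (f : R * R -> R * R) : R * R -> R * R :=
  'D_((1 : R), (0 : R)) f.
Definition dx2 {R : realType} (f : R * R -> R * R) : R * R -> R * R :=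
  'D_((0 : R), (1 : R)) f.

Definition pderiv {R : realType} (i j : nat) (f : R * R -> R * R) :
  R * R -> R * R := iter i dx1 (iter j dx2 f).

Definition laplacian {R : realType} (f : R * R -> R * R) : R * R -> R * R :=
  fun x => pderiv 2 0 f x + pderiv 0 2 f x.

Definition smooth_on {R : realType} (Omega : set (R * R)) (f : R * R -> R * R)
  : Prop :=
  forall (i j : nat) (x : R * R), Omega x -> differentiable (pderiv i j f) x.

Definition L2_on {R : realType} (Omega : set (R * R)) (f : R * R -> R * R)
  : Prop :=
  ((@lebesgue_measure R) \x (@lebesgue_measure R))%E.-integrable Omega
     (fun x => (cabs2 (f x))%:E).

Definition taylor_hom {R : realType} (f : R * R -> R * R) (x0 : R * R)
  (n : nat) (y : R * R) : R * R :=
  \sum_(k < n.+1)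
     ((k`!%:R * (n - k)`!%:R)^-1 * y.1 ^+ k * y.2 ^+ (n - k))
       *: pderiv k (n - k) f x0.

Definition Vani_infinite {R : realType} (f : R * R -> R * R) (x0 : R * R)
  : Prop :=
  forall (n : nat) (y : R * R), taylor_hom f x0 n y = 0.

Definition rotv {R : realType} (theta : R) (v : R * R) : R * R :=
  (cos theta * v.1 - sin theta * v.2, sin theta * v.1 + cos theta * v.2).

Definition unit_vec {R : realType} (v : R * R) : Prop := v.1 ^+ 2 + v.2 ^+ 2 = 1.

Definition segment {R : realType} (x0 e : R * R) (h : R) : set (R * R) :=
  [set x0 + t *: e | t in `[0, h]].

(* Main.v *)
Require Import Defs.
From HB Require Import structures.
From mathcomp Require Import all_boot all_order all_algebra.
From mathcomp Require Import all_classical all_reals all_analysis.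
From mathcomp Require Import ring lra zify.
Import Order.TTheory GRing.Theory Num.Theory.
Import numFieldNormedType.Exports.
Local Open Scope classical_set_scope.
Local Open Scope ring_scope.

(** The derivatives of u of order N at x0 form a symmetric N-linear form in N
directions.  Suppose that all derivatives of order less than N vanish at x0.
Write e = e^- and nu for its normal.  By the Helmholtz equation the form of
order N is trace free, so it is determined by A = D_e^N u (x0) and
B = D_e^(N-1) D_nu u (x0), and in the direction making an angle theta with e
the N-th derivative is cos(N theta) A + sin(N theta) B.  Differentiating the
impedance condition N - 1 times along Gamma^- gives B = 0, the lower order term
being killed by the induction hypothesis; differentiating u = 0 along Gamma^+
gives cos(N alpha pi) A = 0, where the cosine does not vanish because alpha is
irrational. *)

(** * Symmetry of second derivatives *)

Section symmetric_derivatives.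
Context {R : realType} {V : normedModType R}.
Implicit Types (f G H : V -> R) (x v w : V).

Lemma is_derive_line {W : normedModType R} (f : V -> W) (c v : V) (s : R) (df : W) :
  is_derive (s *: v + c) v f df ->
  is_derive s 1 (fun t : R => f (t *: v + c)) df.
Proof.
move=> [dfv <-].
have E : (fun h : R => h^-1 *: (f ((h *: (1 : R) + s) *: v + c) - f (s *: v + c)))
       = (fun h => h^-1 *: (f (h *: v + (s *: v + c)) - f (s *: v + c))).
  by apply/funext => h; rewrite [_ *: (1 : R)]mulr1 scalerDl addrA.
by split; rewrite /derivable /derive /= E.
Qed.

(* Mean value theorem for s |-> f (x + s v + h w) - f (x + s v) on [0, h]. *)
Lemma second_difference f G x v w :
  (\forall y \near x, is_derive y v f (G y)) -> differentiable G x ->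
  forall e : R, 0 < e -> \forall h \near 0^'+,
  `|f (h *: v + (h *: w + x)) - f (h *: v + x) - f (h *: w + x) + f x
    - h ^+ 2 * 'D_w G x| <= e * h ^+ 2.
Proof.
move=> dfv dG e e0; rewrite deriveE //.
set L := 'd G x.
(* For [0 <= s <= h], both [s *: v] and [s *: v + h *: w] have norm at most [h * M]; the [1] makes
   [M] positive. Two errors of size [e' * (h * M)] then add up to [e * h]. *)
pose M : R := `|v| + `|w| + 1.
have M0 : 0 < M by rewrite /M ltr_wpDl // addr_ge0.
pose e' := e / (2 * M).
have e'0 : 0 < e' by rewrite divr_gt0 // mulr_gt0.
have nG : \forall z \near (0 : V), `|G (z + x) - (G x + L z)| <= e' * `|z|.
  by have /eqaddoP/(_ _ e'0) := diff_locally dG.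
have nf : \forall z \near (0 : V), is_derive (z + x) v f (G (z + x)).
  by move: dfv; rewrite (near_shift 0 x); apply: filterS => z /=; rewrite subr0.
have /nbhs_ballP[d /= d0 Hd] : nbhs (0 : V) (fun z =>
    `|G (z + x) - (G x + L z)| <= e' * `|z| /\
    is_derive (z + x) v f (G (z + x))) by exact: filterI nG nf.
have small (z : V) : `|z| < d ->
    `|G (z + x) - (G x + L z)| <= e' * `|z| /\ is_derive (z + x) v f (G (z + x)).
  by move=> zd; apply: Hd; rewrite -ball_normE /= sub0r normrN.
near=> h.
have h0 : 0 < h by near: h; exact: nbhs_right_gt.
have hM : h * M < d.
  rewrite -ltr_pdivlMr //; near: h; apply: nbhs_right_lt; exact: divr_gt0.
have nv (s : R) : 0 <= s -> s <= h -> `|s *: v| <= h * M.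
  move=> s0 sh; rewrite normrZ ger0_norm //.
  apply: ler_pM => //; rewrite /M -addrA lerDl addr_ge0 //.
have nvw (s : R) : 0 <= s -> s <= h -> `|s *: v + h *: w| <= h * M.
  move=> s0 sh; apply: (le_trans (ler_normD _ _)).
  rewrite !normrZ (ger0_norm s0) (gtr0_norm h0).
  have : s * `|v| <= h * `|v| by apply: ler_wpM2r.
  rewrite /M; nra.
pose phi (s : R) := f (s *: v + (h *: w + x)) - f (s *: v + x).
pose dphi (s : R) : R := G (s *: v + (h *: w + x)) - G (s *: v + x).
have dphiP (s : R) : s \in `[0, h] -> is_derive s 1 phi (dphi s).
  rewrite in_itv /= => /andP[s0 sh].
  have [_ d1] := small _ (le_lt_trans (nv s s0 sh) hM).
  have [_ d2] := small _ (le_lt_trans (nvw s s0 sh) hM).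
  rewrite -addrA in d2.
  have i1 := is_derive_line _ _ _ _ _ d1; have i2 := is_derive_line _ _ _ _ _ d2.
  exact: is_deriveB.
have P1 (s : R) : s \in `]0, h[ -> is_derive s 1 phi (dphi s).
  rewrite in_itv /= => /andP[s0 sh]; apply: dphiP.
  by rewrite in_itv /= !ltW.
have P2 : {within `[0, h], continuous phi}.
  by apply: derivable_within_continuous => s /dphiP[].
have h0' : 0 <= h by exact: ltW.
have [c] := @MVT_segment R phi dphi 0 h h0' P1 P2.
rewrite in_itv /= => /andP[c0 ch]; rewrite subr0 => E.
have [b1 _] := small _ (le_lt_trans (nv c c0 ch) hM).
have [b2 _] := small _ (le_lt_trans (nvw c c0 ch) hM).
have {}b1 := le_trans b1 (ler_wpM2l (ltW e'0) (nv c c0 ch)).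
have {}b2 := le_trans b2 (ler_wpM2l (ltW e'0) (nvw c c0 ch)).
have -> : f (h *: v + (h *: w + x)) - f (h *: v + x) - f (h *: w + x) + f x
    - h ^+ 2 * L w = (dphi c - h * L w) * h.
  rewrite mulrBl -E /phi !scale0r !add0r; ring.
rewrite normrM (gtr0_norm h0) expr2 mulrA ler_wpM2r ?(ltW h0) //.
(* Subtracting the expansions of [G] at the two points, [G x] and [L (c *: v)] cancel and only
   [h * L w] remains. *)
have -> : dphi c - h * L w = (G (c *: v + h *: w + x)
     - (G x + L (c *: v + h *: w))) - (G (c *: v + x) - (G x + L (c *: v))).
  have -> : L (c *: v + h *: w) = L (c *: v) + h * L w.
    by rewrite raddfD [X in _ + X]linearZ.
  rewrite /dphi (addrA (c *: v)); ring.
apply: (le_trans (ler_normB _ _)); apply: (le_trans (lerD b2 b1)).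
have -> : e' * (h * M) + e' * (h * M) = e * h; last by [].
rewrite /e'; field; exact: lt0r_neq0.
Unshelve. all: by end_near. Qed.

(** The second difference is symmetric in [v] and [w]; divided by [h ^+ 2], it tends to either mixed
    derivative. *)
Lemma derive_comm_real f G H x v w :
  (\forall y \near x, is_derive y v f (G y)) ->
  (\forall y \near x, is_derive y w f (H y)) ->
  differentiable G x -> differentiable H x -> 'D_w G x = 'D_v H x.
Proof.
move=> fv fw dv dw; apply/eqP; rewrite -subr_eq0 -normr_le0.
apply/ler_addgt0Pr => e e0; rewrite add0r.
have e2 : 0 < e / 2 by rewrite divr_gt0.
have H1 := second_difference _ _ _ _ w fv dv _ e2.
have H2 := second_difference _ _ _ _ v fw dw _ e2.
near ((0 : R)^'+) => h.
have h0 : 0 < h by near: h; exact: nbhs_right_gt.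
have K1 : `|f (h *: v + (h *: w + x)) - f (h *: v + x) - f (h *: w + x) + f x
    - h ^+ 2 * 'D_w G x| <= e / 2 * h ^+ 2 by near: h.
have K2 : `|f (h *: w + (h *: v + x)) - f (h *: w + x) - f (h *: v + x) + f x
    - h ^+ 2 * 'D_v H x| <= e / 2 * h ^+ 2 by near: h.
have h20 : 0 < h ^+ 2 by rewrite exprn_gt0.
rewrite -(ler_pM2r h20) -[X in _ * X](gtr0_norm h20) -normrM.
have -> : e * h ^+ 2 = e / 2 * h ^+ 2 + e / 2 * h ^+ 2 by field.
apply: le_trans (lerD K2 K1); apply: le_trans (ler_normB _ _).
rewrite le_eqVlt; apply/orP; left; apply/eqP; congr `|_|.
rewrite (addrCA (h *: w)); ring.
Unshelve. all: by end_near. Qed.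

End symmetric_derivatives.

(** * Directional derivatives under local equality, linear maps and linear combinations *)

Section generic_derivatives.
Context {R : realType}.

(** The first-order expansion of [f] at [x] is also one of [g], and such an expansion determines the
    differential. *)
Lemma near_eq_differentiable {V W : normedModType R} (f g : V -> W) (x : V) :
  (\near x, f x = g x) -> differentiable f x -> differentiable g x.
Proof.
move=> fg /diff_locallyP [c E].
suff E' : g \o shift x = cst (g x) + 'd f x +o_ (0 : V) id.
  by apply/diff_locallyP; rewrite (diff_unique c E').
apply/eqaddoP => e e0.
have /eqaddoP/(_ _ e0) Ef := E.
have Eg : \forall z \near (0 : V), f (z + x) = g (z + x).
  by move: fg; rewrite (near_shift 0 x); apply: filterS => z /=; rewrite subr0.
near=> z.
have -> : (g \o shift x - (cst (g x) + 'd f x)) z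
   = (f \o shift x - (cst (f x) + 'd f x)) z.
  rewrite /= -(nbhs_singleton fg) !fctE /=; congr (_ - _).
  by apply/esym; near: z.
by near: z.
Unshelve. all: by end_near. Qed.

Lemma is_derive_linear_comp {V W W' : normedModType R} (l : {linear W -> W'})
    (f : V -> W) (x v : V) (df : W) :
  continuous l -> is_derive x v f df -> is_derive x v (l \o f) (l df).
Proof.
move=> cl [fv <-].
have E : (fun h : R => h^-1 *: (((l \o f) \o shift x) (h *: v) - (l \o f) x))
   = l \o (fun h => h^-1 *: ((f \o shift x) (h *: v) - f x)).
  by apply/funext => h /=; rewrite linearZ [in RHS]raddfB.
have c : h^-1 *: (((l \o f) \o shift x) (h *: v) - (l \o f) x) @[h --> 0^']
    --> l ('D_v f x).
  by rewrite E; apply: (cvg_comp _ _ fv); exact: cl.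
by split; [apply/cvg_ex; exists (l ('D_v f x)) | exact: cvg_lim].
Qed.

(** The two-sided limit of the quotients is also their limit from the right, where they vanish. A
    segment gives only such one-sided information at its endpoint. *)
Lemma derive_eq0_ray {V W : normedModType R} (f : V -> W) (x v : V) (d : R) :
  0 < d -> derivable f x v -> (forall t, 0 <= t < d -> f (t *: v + x) = 0) ->
  'D_v f x = 0.
Proof.
move=> d0 fv f0.
have /cvg_dnbhs_at_right c :
    h^-1 *: ((f \o shift x) (h *: v) - f x) @[h --> 0^'] --> 'D_v f x.
  exact: fv.
apply: (@norm_cvg_unique _ _ _ _ _ _ c).
apply: (cvg_near_cst).
near=> h; rewrite /= f0.
  have := f0 0; rewrite scale0r add0r => ->; last by rewrite lexx.
  by rewrite subr0 scaler0.
apply/andP; split; near: h; [exact: nbhs_right_ge|exact: nbhs_right_lt].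
Unshelve. all: by end_near. Qed.

Lemma is_derive_fst {V W W' : normedModType R} (f : V -> W * W') (x v : V) df :
  is_derive x v f df -> is_derive x v (fst \o f) df.1.
Proof.
move=> fv; apply: (is_derive_linear_comp (fst : {linear (W * W')%type -> W})) => // z.
exact: cvg_fst.
Qed.

Lemma is_derive_snd {V W W' : normedModType R} (f : V -> W * W') (x v : V) df :
  is_derive x v f df -> is_derive x v (snd \o f) df.2.
Proof.
move=> fv; apply: (is_derive_linear_comp (snd : {linear (W * W')%type -> W'})) => // z.
exact: cvg_snd.
Qed.

Lemma differentiable_fst {V W W' : normedModType R} (f : V -> W * W') (x : V) :
  differentiable f x -> differentiable (fst \o f) x.
Proof.
move=> df; apply: differentiable_comp => //.
apply: (linear_differentiable (f := (fst : {linear (W * W')%type -> W}))) => z.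
exact: cvg_fst.
Qed.

Lemma differentiable_snd {V W W' : normedModType R} (f : V -> W * W') (x : V) :
  differentiable f x -> differentiable (snd \o f) x.
Proof.
move=> df; apply: differentiable_comp => //.
apply: (linear_differentiable (f := (snd : {linear (W * W')%type -> W'}))) => z.
exact: cvg_snd.
Qed.

Lemma derive_comm {V : normedModType R} (f G H : V -> R * R) (x v w : V) :
  (\forall y \near x, is_derive y v f (G y)) ->
  (\forall y \near x, is_derive y w f (H y)) ->
  differentiable G x -> differentiable H x -> 'D_w G x = 'D_v H x.
Proof.
move=> fG fH dG dH.
have wG := derivableP (diff_derivable (v := w) dG).
have vH := derivableP (diff_derivable (v := v) dH).
have E1 : ('D_w G x).1 = ('D_v H x).1.
  have [_ <-] := is_derive_fst _ _ _ _ wG; have [_ <-] := is_derive_fst _ _ _ _ vH.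
  apply: (derive_comm_real (fst \o f)).
  - by apply: filterS fG => y; exact: is_derive_fst.
  - by apply: filterS fH => y; exact: is_derive_fst.
  - exact: differentiable_fst.
  - exact: differentiable_fst.
have E2 : ('D_w G x).2 = ('D_v H x).2.
  have [_ <-] := is_derive_snd _ _ _ _ wG; have [_ <-] := is_derive_snd _ _ _ _ vH.
  apply: (derive_comm_real (snd \o f)).
  - by apply: filterS fG => y; exact: is_derive_snd.
  - by apply: filterS fH => y; exact: is_derive_snd.
  - exact: differentiable_snd.
  - exact: differentiable_snd.
by move: E1 E2; case: ('D_w G x) => ? ?; case: ('D_v H x) => ? ? /= -> ->.
Qed.

Lemma derive_lincomb {V W : normedModType R} (f g : V -> W) (a b : R) (x v : V) :
  derivable f x v -> derivable g x v ->
  'D_v (a *: f + b *: g) x = a *: 'D_v f x + b *: 'D_v g x.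
Proof. by move=> df dg; rewrite deriveD ?deriveZ //; exact: derivableZ. Qed.

Lemma differentiable_lincomb {V W : normedModType R} (f g : V -> W) (a b : R) (x : V) :
  differentiable f x -> differentiable g x -> differentiable (a *: f + b *: g) x.
Proof. by move=> df dg; apply: differentiableD; exact: differentiableZ. Qed.

Lemma derive_direction_lin {V W : normedModType R} (f : V -> W) (a b : R) (x v w : V) :
  differentiable f x -> 'D_(a *: v + b *: w) f x = a *: 'D_v f x + b *: 'D_w f x.
Proof.
move=> df; rewrite !deriveE //.
by rewrite raddfD [X in X + _]linearZ [X in _ + X]linearZ.
Qed.

End generic_derivatives.

(** * Iterated directional derivatives of smooth functions *)

Section smooth_functions.
Context {R : realType} (Omega : set (R * R)).
Hypothesis Oopen : open Omega.
Implicit Types (f g : R * R -> R * R) (v w x : R * R).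

Local Notation "f =O g" := (forall x, Omega x -> f x = g x) (at level 70).

Let nearO (P : R * R -> Prop) x :
  (forall y, Omega y -> P y) -> Omega x -> \forall y \near x, P y.
Proof. by move=> PO Ox; apply: filterS PO _; exact: open_nbhs_nbhs. Qed.

Lemma derive_eqO f g v : f =O g -> 'D_v f =O 'D_v g.
Proof. by move=> fg x Ox; apply: near_eq_derive; exact: nearO. Qed.

Lemma pderiv_eqO f g i j : f =O g -> pderiv i j f =O pderiv i j g.
Proof.
move=> fg; rewrite /pderiv; elim: i => [|i IH] /=; last exact: derive_eqO.
by elim: j => [//|j IH] /=; exact: derive_eqO.
Qed.

Lemma smooth_eqO f g : f =O g -> smooth_on Omega f -> smooth_on Omega g.
Proof.
move=> fg sf i j x Ox; apply: near_eq_differentiable (sf i j x Ox).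
by apply: nearO Ox; exact: pderiv_eqO.
Qed.

(** In [pderiv] the [dx2] derivatives are innermost, so an outer [dx2] has to move inward past each
    [dx1]. *)
Lemma dx2_pderiv f i j : smooth_on Omega f ->
  dx2 (pderiv i j f) =O pderiv i j.+1 f.
Proof.
move=> sf; elim: i => [//|i IH] x Ox.
apply: (derive_comm (pderiv i j f) (pderiv i.+1 j f) (pderiv i j.+1 f)).
- by apply: nearO Ox => y Oy; exact/derivableP/diff_derivable/sf.
- apply: nearO Ox => y Oy; rewrite -IH //; exact/derivableP/diff_derivable/sf.
- exact: (sf i.+1 j).
- exact: (sf i j.+1).
Qed.

(** Moving the innermost [dx1] past the [dx2] derivatives turns [pderiv i j (dx1 f)] into
    [pderiv i.+1 j f] on [Omega]. *)
Lemma smooth_dx1 f : smooth_on Omega f -> smooth_on Omega (dx1 f).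
Proof.
move=> sf i j x Ox; apply: near_eq_differentiable (sf i.+1 j x Ox).
apply: nearO Ox => {x}; rewrite {1}/pderiv iterSr; apply: (pderiv_eqO _ _ i 0).
elim: j => [//|j IH] x Ox; transitivity (dx2 (pderiv 1 j f) x).
  by rewrite dx2_pderiv.
exact: (derive_eqO _ _ _ IH).
Qed.

Lemma smooth_dx2 f : smooth_on Omega f -> smooth_on Omega (dx2 f).
Proof. by move=> sf i j; rewrite /pderiv -iterSr; exact: sf. Qed.

Let derive_lincombO F f g (a b : R) v :
  (forall x, Omega x -> differentiable f x) ->
  (forall x, Omega x -> differentiable g x) ->
  F =O a *: f + b *: g -> 'D_v F =O a *: 'D_v f + b *: 'D_v g.
Proof.
move=> df dg FE x Ox; apply: (etrans (derive_eqO _ _ v FE x Ox)).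
by apply: derive_lincomb; apply: diff_derivable; [exact: df|exact: dg].
Qed.

Lemma pderiv_lin f g (a b : R) i j : smooth_on Omega f -> smooth_on Omega g ->
  pderiv i j (a *: f + b *: g) =O a *: pderiv i j f + b *: pderiv i j g.
Proof.
move=> sf sg; elim: i => [|i IH].
  elim: j => [//|j IH].
  exact: (derive_lincombO _ _ _ a b (0, 1) (sf 0%N j) (sg 0%N j) IH).
exact: (derive_lincombO _ _ _ a b (1, 0) (sf i j) (sg i j) IH).
Qed.

Lemma smooth_lin f g (a b : R) : smooth_on Omega f -> smooth_on Omega g ->
  smooth_on Omega (a *: f + b *: g).
Proof.
move=> sf sg i j x Ox; apply: (@near_eq_differentiable _ _ _
  (a *: pderiv i j f + b *: pderiv i j g)).
  by apply: nearO Ox => y Oy; rewrite pderiv_lin.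
by apply: differentiable_lincomb; [exact: sf|exact: sg].
Qed.

Lemma smooth_differentiable f x : smooth_on Omega f -> Omega x -> differentiable f x.
Proof. by move=> sf; exact: (sf 0 0). Qed.

Lemma derive_lin f x v w (a b : R) : smooth_on Omega f -> Omega x ->
  'D_(a *: v + b *: w) f x = a *: 'D_v f x + b *: 'D_w f x.
Proof.
by move=> sf Ox; apply: derive_direction_lin; exact: smooth_differentiable.
Qed.

Lemma smooth_derive f v : smooth_on Omega f -> smooth_on Omega ('D_v f).
Proof.
move=> sf; apply: (@smooth_eqO (v.1 *: dx1 f + v.2 *: dx2 f)).
  move=> x Ox; rewrite -[LHS](derive_lin _ _ _ _ _ _ sf Ox).
  congr ('D_ _ f x); case: v => v1 v2.
  by congr (_, _); rewrite /= [_ *: 1]mulr1 [_ *: 0]mulr0 ?addr0 ?add0r.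
by apply: smooth_lin; [exact: smooth_dx1|exact: smooth_dx2].
Qed.

Lemma smooth_derive_comm f v w : smooth_on Omega f ->
  'D_v ('D_w f) =O 'D_w ('D_v f).
Proof.
move=> sf x Ox; have d g (y u : R * R) : smooth_on Omega g -> Omega y ->
    is_derive y u g ('D_u g y).
  by move=> sg Oy; exact/derivableP/diff_derivable/smooth_differentiable.
apply: (derive_comm f).
- by apply: nearO Ox => y Oy; exact: d.
- by apply: nearO Ox => y Oy; exact: d.
- by apply: smooth_differentiable => //; exact: smooth_derive.
- by apply: smooth_differentiable => //; exact: smooth_derive.
Qed.

(** The head of the list is the outermost derivative. With lists of directions, symmetry becomes
    invariance under permutation, and multilinearity concerns one letter at a time. *)
Definition derive_word f (s : seq (R * R)) : R * R -> R * R :=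
  foldr (fun v g => 'D_v g) f s.

Lemma smooth_word f s : smooth_on Omega f -> smooth_on Omega (derive_word f s).
Proof. by move=> sf; elim: s => [|v s IH]; [exact: sf|exact: smooth_derive]. Qed.

Lemma derive_word_cat f s t :
  derive_word f (s ++ t) = derive_word (derive_word f t) s.
Proof. exact: foldr_cat. Qed.

Lemma pderiv_word f i j :
  pderiv i j f = derive_word f (nseq i (1, 0) ++ nseq j (0, 1)).
Proof.
have iterE v g k : iter k (fun g => 'D_v g) g = derive_word g (nseq k v).
  by elim: k => [|k IH]; [|exact: (congr1 (fun g => 'D_v g) IH)].
rewrite derive_word_cat.
exact: (etrans (iterE _ _ i) (congr1 (derive_word ^~ _) (iterE _ _ j))).
Qed.

Lemma derive_word_eqO f g s : f =O g -> derive_word f s =O derive_word g s.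
Proof. by move=> fg; elim: s => [|v s IH]; [exact: fg|exact: derive_eqO]. Qed.

(** A letter travels to the front by exchanges of neighbours; the rest is induction on the word. *)
Lemma derive_word_perm f s t : smooth_on Omega f -> perm_eq s t ->
  derive_word f s =O derive_word f t.
Proof.
move=> sf.
have front v s1 s2 : derive_word f (s1 ++ v :: s2) =O derive_word f (v :: s1 ++ s2).
  elim: s1 => [|w s1 IH] x Ox; first by [].
  apply: (etrans (derive_eqO _ _ w IH x Ox)).
  exact: (smooth_derive_comm _ w v (smooth_word f (s1 ++ s2) sf) x Ox).
elim: s t => [|v s IH] t st x Ox.
  by move: st; rewrite perm_sym => /perm_nilP ->.
have vt : v \in t by rewrite -(perm_mem st) mem_head.
case/splitPr: vt st => t1 t2 st; rewrite (front v t1 t2 x Ox).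
apply: (derive_eqO _ _ v _ x Ox); apply: IH.
by rewrite -(perm_cons v) (permPl st) perm_catC /= perm_cons perm_catC.
Qed.

Lemma derive_word_lin f g (a b : R) s : smooth_on Omega f -> smooth_on Omega g ->
  derive_word (a *: f + b *: g) s =O a *: derive_word f s + b *: derive_word g s.
Proof.
move=> sf sg; elim: s => [//|v s IH].
apply: (derive_lincombO _ _ _ a b v _ _ IH) => x Ox.
- by apply: smooth_differentiable => //; exact: smooth_word.
- by apply: smooth_differentiable => //; exact: smooth_word.
Qed.

(** The Laplacian is the trace of the Hessian form, which is the same in every orthonormal basis. *)
Lemma laplacian_rot f (a b : R) : smooth_on Omega f -> a ^+ 2 + b ^+ 2 = 1 ->
  forall x, Omega x ->
  'D_(a, b) ('D_(a, b) f) x + 'D_(- b, a) ('D_(- b, a) f) x = laplacian f x.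
Proof.
move=> sf ab x Ox.
have vE (c d : R) : (c, d) = c *: ((1 : R), (0 : R)) + d *: ((0 : R), (1 : R)).
  by congr (_, _); rewrite /= [_ *: 1]mulr1 [_ *: 0]mulr0 ?addr0 ?add0r.
pose P v w := 'D_v ('D_w f) x.
have Plin c d v w z : P (c *: v + d *: w) z = c *: P v z + d *: P w z.
  exact: (derive_lin _ _ _ _ _ _ (smooth_derive f z sf) Ox).
have Psym v w : P v w = P w v := smooth_derive_comm f v w sf x Ox.
rewrite -[LHS]/(P (a, b) (a, b) + P (- b, a) (- b, a)).
rewrite -[RHS]/(P (1, 0) (1, 0) + P (0, 1) (0, 1)).
clearbody P; rewrite (vE a b) (vE (- b) a).
set e1 := ((1 : R), (0 : R)); set e2 := ((0 : R), (1 : R)).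
have DD c d : P (c *: e1 + d *: e2) (c *: e1 + d *: e2) =
    c ^+ 2 *: P e1 e1 + (c * d *+ 2) *: P e1 e2 + d ^+ 2 *: P e2 e2.
  rewrite Plin ![P _ (_ + _)]Psym !Plin (Psym e2 e1).
  by rewrite !scalerDr !scalerA -!expr2 (mulrC d c) mulr2n scalerDl !addrA.
rewrite !DD.
move: (P e1 e1) (P e1 e2) (P e2 e2) => [A1 A2] [B1 B2] [D1 D2].
(* The left side carries the factor [a ^+ 2 + b ^+ 2]; inserting it on the right leaves a polynomial
   identity. *)
have E (z : R) : z = (a ^+ 2 + b ^+ 2) * z by rewrite ab mul1r.
congr (_, _) => /=; rewrite /GRing.scale /=.
  rewrite [RHS]E; ring.
rewrite [RHS]E; ring.
Qed.

(** One side adds doubled letters outside the word, the other inside; the resulting words are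
    permutations of each other. *)
Lemma laplacian_word f s : smooth_on Omega f ->
  laplacian (derive_word f s) =O derive_word (laplacian f) s.
Proof.
move=> sf x Ox.
have swap v : derive_word f (v :: v :: s) x = derive_word (derive_word f [:: v; v]) s x.
  rewrite -derive_word_cat.
  exact: (derive_word_perm _ _ _ sf (permEl (perm_catC [:: v; v] s)) x Ox).
have comb (F G : R * R -> R * R) y : F y + G y = (1 *: F + 1 *: G) y.
  by rewrite !scale1r.
have lapE : laplacian f =O 1 *: derive_word f [:: (1, 0); (1, 0)]
    + 1 *: derive_word f [:: (0, 1); (0, 1)].
  by move=> y _; exact: comb (dx1 (dx1 f)) (dx2 (dx2 f)) y.
have ss v := smooth_word f [:: v; v] sf.
apply/esym; apply: (etrans (derive_word_eqO _ _ s lapE x Ox)).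
apply: (etrans (derive_word_lin _ _ 1 1 s (ss (1, 0)) (ss (0, 1)) x Ox)).
apply: (etrans (esym (comb _ _ x))).
exact: esym (congr2 +%R (swap (1, 0)) (swap (0, 1))).
Qed.

Lemma helmholtz_word f s (lambda : R) : smooth_on Omega f ->
  (forall x, Omega x -> - laplacian f x = lambda *: f x) ->
  forall x, Omega x -> laplacian (derive_word f s) x = - lambda *: derive_word f s x.
Proof.
move=> sf fE x Ox; rewrite laplacian_word //.
have lapE : laplacian f =O - lambda *: f + 0 *: f.
  by move=> y Oy; rewrite scale0r addr0 -[LHS]opprK fE // -scaleNr.
apply: (etrans (derive_word_eqO _ _ s lapE x Ox)).
apply: (etrans (derive_word_lin _ _ (- lambda) 0 s sf sf x Ox)).
by move: (derive_word f s) => g; rewrite scale0r addr0.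
Qed.

End smooth_functions.

(** * Differentiating a boundary condition along its segment *)

Section boundary_lines.
Context {R : realType} (Omega : set (R * R)).
Hypothesis Oopen : open Omega.

(** This form covers both segments: [C = 0] for the nodal one, [f] a normal derivative of [g] for
    the other. The half-open range of [t] always leaves a piece of the segment ahead, so a one-sided
    derivative suffices, even at the corner [t = 0]. *)
Lemma derive_word_ray (f g : R * R -> R * R) (C x0 e : R * R) (h : R) (n : nat) :
  smooth_on Omega f -> smooth_on Omega g -> segment x0 e h `<=` Omega ->
  (forall x, segment x0 e h x -> f x + cmul C (g x) = 0) ->
  forall t, 0 <= t < h ->
  derive_word f (nseq n e) (x0 + t *: e)
    + cmul C (derive_word g (nseq n e) (x0 + t *: e)) = 0.
Proof.
move=> sf sg sO fg0.
have onseg t : 0 <= t < h -> segment x0 e h (x0 + t *: e).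
  by move=> /andP[t0 th]; exists t => //=; rewrite in_itv /= t0 ltW.
elim: n => [|n IH] t th; first exact/fg0/onseg.
have Ox := sO _ (onseg t th).
set x := x0 + t *: e in Ox *.
set F := derive_word f (nseq n e) in IH; set G := derive_word g (nseq n e) in IH.
have dF : is_derive x e F ('D_e F x).
  apply/derivableP/diff_derivable/(smooth_differentiable _ _ _ _ Ox).
  exact: smooth_word.
have dG : is_derive x e G ('D_e G x).
  apply/derivableP/diff_derivable/(smooth_differentiable _ _ _ _ Ox).
  exact: smooth_word.
have dF1 := is_derive_fst _ _ _ _ dF; have dF2 := is_derive_snd _ _ _ _ dF.
have dG1 := is_derive_fst _ _ _ _ dG; have dG2 := is_derive_snd _ _ _ _ dG.
have ht : 0 < h - t by case/andP: th => _; rewrite subr_gt0.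
have ray s : 0 <= s < h - t -> F (s *: e + x) + cmul C (G (s *: e + x)) = 0.
  move=> /andP[s0 sh]; have := IH (s + t); rewrite scalerDl addrCA; apply.
  case/andP: th => t0 _; rewrite addr_ge0 //=; lra.
(* These are the real and imaginary parts of [F + cmul C G], differentiated along [e]. *)
have r1 := is_deriveD (is_deriveD dF1 (is_deriveZ C.1 dG1)) (is_deriveZ (- C.2) dG2).
have r2 := is_deriveD (is_deriveD dF2 (is_deriveZ C.1 dG2)) (is_deriveZ C.2 dG1).
have z1 := derive_val (is_derive := r1); have z2 := derive_val (is_derive := r2).
rewrite (derive_eq0_ray _ _ _ _ ht) in z1; first last.
- move=> s sh; have [E _] := ray s sh; rewrite -[RHS]E !fctE /= /GRing.scale /=; ring.
- exact: (ex_derive (is_derive := r1)).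
rewrite (derive_eq0_ray _ _ _ _ ht) in z2; first last.
- move=> s sh; have [_ E] := ray s sh; rewrite -[RHS]E !fctE /= /GRing.scale /=; ring.
- exact: (ex_derive (is_derive := r2)).
rewrite -[LHS]/('D_e F x + cmul C ('D_e G x)).
move: ('D_e F x) ('D_e G x) z1 z2 => [a1 a2] [b1 b2]; rewrite /GRing.scale /= => z1 z2.
by congr (_, _) => /=; [rewrite z1|rewrite z2]; ring.
Qed.

End boundary_lines.

(** The coefficients are the inner products of [v] with [e] and with its quarter turn. *)
Lemma orthonormal_coordinates {R : realType} (e v : R * R) : unit_vec e ->
  v = (v.1 * e.1 + v.2 * e.2) *: e + (v.2 * e.1 - v.1 * e.2) *: (- e.2, e.1).
Proof.
rewrite /unit_vec; case: e v => e1 e2 [v1 v2] /= E.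
have E1 (z : R) : z = z * (e1 ^+ 2 + e2 ^+ 2) by rewrite E mulr1.
by congr (_, _); apply: (etrans (E1 _)); rewrite /= /GRing.scale /=; ring.
Qed.

(** * Trace-free symmetric forms *)

(** Removing the integer part of [x] changes the cosine only by a sign, and on [[0, pi]] the cosine
    is injective with zero [pi / 2]. *)
Lemma cos_mulpi_eq0 {R : realType} (x : R) : 0 <= x -> cos (x * pi) = 0 ->
  exists n : nat, x = n%:R + 2^-1.
Proof.
move=> x0 cx; exists (Num.truncn x).
have := truncn_itv x0; set n := Num.truncn x => /andP[nx xn].
pose y := x - n%:R.
have y0 : 0 <= y by rewrite subr_ge0.
have y1 : y <= 1 by rewrite lerBlDl natr1 ltW.
have xE : x = n%:R + y by rewrite /y addrC subrK.
have pi0 := pi_gt0 R.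
have cy : cos (y * pi) = 0.
  move: cx; rewrite xE mulrDl addrC mulr_natl (alternatingn (@cosDpi R)).
  by move/eqP; rewrite mulf_eq0 signr_eq0 /= => /eqP.
rewrite {1}xE; congr (_ + _); apply: (mulIf (lt0r_neq0 pi0)).
apply: cos_inj; rewrite ?in_itv /=.
- by rewrite mulr_ge0 ?(ltW pi0) //= ler_piMl // ltW.
- apply/andP; split; lra.
- by rewrite cy mulrC cos_pihalf.
Qed.

(** A zero would give [n * a = k + 1/2], that is [a = (2k + 1) / (2n)]. *)
Lemma cos_irrational {R : realType} (a : R) (n : nat) :
  0 < a -> ~ rational a -> cos (n%:R * (a * pi)) != 0.
Proof.
move=> a0 Qa; apply/eqP; rewrite mulrA => /cos_mulpi_eq0.
case; first by rewrite mulr_ge0 // ltW.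
move=> k E; apply: Qa; apply/rationalP; exists (k.*2.+1%:Z), n.*2.
have n0 : n%:R != 0 :> R.
  by apply/eqP => n0; move: E; rewrite n0 mul0r; have := ler0n R k; lra.
have -> : a = (k%:R + 2^-1) / n%:R by rewrite -E mulrAC divff // mul1r.
rewrite -pmulrn -addn1 natrD -!mul2n !natrM; field; exact: n0.
Qed.

(* W s stands for the derivative at x0 along the list of directions s. *)
Section harmonic_words.
Variables (R : realType) (E : lmodType R) (W : seq (R * R) -> E).
Hypothesis Wperm : forall s t, perm_eq s t -> W s = W t.
Hypothesis Wlin : forall (a b : R) v w s,
  W (a *: v + b *: w :: s) = a *: W (v :: s) + b *: W (w :: s).

Ltac perm := apply: Wperm; apply/permP => ?;
  rewrite /= ?(count_cat, count_nseq) /= ?(count_cat, count_nseq); lia.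

Variables (e nu ep : R * R) (theta : R) (lambda : R).
Hypothesis Wlap : forall s,
  W (e :: e :: s) + W (nu :: nu :: s) = - lambda *: W s.
Hypothesis basis : forall v : R * R, exists a b : R, v = a *: e + b *: nu.
Hypothesis epE : ep = cos theta *: e + sin theta *: nu.
Hypothesis cos_neq0 : forall n : nat, cos (n%:R * theta) != 0.
(** The nodal condition, differentiated along [ep]; [n = 0] gives the value at the corner. The next
    hypothesis is what the differentiated impedance condition yields once its term without normal
    derivative vanishes. *)
Hypothesis Wep : forall n, W (nseq n ep) = 0.
Hypothesis Wnu : forall n, W (nseq n e) = 0 -> W (nu :: nseq n e) = 0.

Section degree.
Variable m : nat.
Hypothesis low : forall s, (size s <= m)%N -> W s = 0.

(** The term in [lambda] has lower order and is killed by [low]. *)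
Let Wtrace_free s : (size s <= m)%N -> W (nu :: nu :: s) = - W (e :: e :: s).
Proof. by move=> sm; apply/eqP; rewrite -addr_eq0 addrC Wlap low // scaler0. Qed.

(** Replacing one more [e] by [ep] rotates the pair of values by [theta], because two letters [nu]
    count as minus two letters [e]. The second value is carried along so that the induction closes;
    it starts at 0 by the impedance condition. *)
Lemma words_rotate k : (k <= m)%N ->
  W (nseq k ep ++ e :: nseq (m - k) e)
    = cos (k%:R * theta) *: W (nseq m.+1 e) /\
  W (nseq k ep ++ nu :: nseq (m - k) e)
    = - sin (k%:R * theta) *: W (nseq m.+1 e).
Proof.
have B0 : W (nu :: nseq m e) = 0 by apply/Wnu/low; rewrite size_nseq.
elim: k => [_|k IH km].
  by rewrite subn0 /= mul0r cos0 sin0 oppr0 scale0r scale1r.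
have [H1 H2] := IH (ltnW km).
(* One [e] is split off the last block: it is the letter that becomes [ep]. *)
have mk : (m - k = (m - k.+1).+1)%N by rewrite subnSK.
rewrite mk /= in H1 H2.
set q := nseq (m - k.+1) e in H1 H2 *; set r := nseq k ep in H1 H2 *.
set A := W (nseq m.+1 e) in H1 H2 *.
have P1 : W (e :: r ++ e :: q) = W (r ++ e :: e :: q) by perm.
have P2 : W (nu :: r ++ e :: q) = W (r ++ nu :: e :: q) by perm.
have P3 : W (e :: r ++ nu :: q) = W (r ++ nu :: e :: q) by perm.
have P4 : W (nu :: r ++ nu :: q) = - W (r ++ e :: e :: q).
  transitivity (W (nu :: nu :: r ++ q)); first by perm.
  rewrite Wtrace_free; first by congr (- _); perm.
  by rewrite size_cat !size_nseq; lia.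
rewrite /= {1 3}epE !Wlin P1 P2 P3 P4 H1 H2 -natr1 mulrDl mul1r.
rewrite -!scaleNr !scalerA -!scalerDl cosD sinD.
split; congr (_ *: _); ring.
Qed.

(** The nodal condition kills the pure [e] word, the trace condition then kills all words in [e] and
    [nu], and multilinearity the remaining ones. *)
Lemma words_degree_eq0 s : size s = m.+1 -> W s = 0.
Proof.
have A0 : W (nseq m.+1 e) = 0.
  (* The rotation formula stops at [m] letters [ep], leaving one free letter; expanding the last
     [ep] there gives the cosine of [m.+1] times [theta]. *)
  have [] := words_rotate m (leqnn m); rewrite subnn => H1 H2.
  have P1 : W (e :: nseq m ep) = W (nseq m ep ++ [:: e]) by perm.
  have P2 : W (nu :: nseq m ep) = W (nseq m ep ++ [:: nu]) by perm.
  have := Wep m.+1; rewrite /= {1}epE Wlin P1 P2 H1 H2 !scalerA -scalerDl.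
  have -> : cos theta * cos (m%:R * theta) + sin theta * - sin (m%:R * theta)
     = cos (m.+1%:R * theta) by rewrite -natr1 mulrDl mul1r cosD; ring.
  by move/eqP; rewrite scaler_eq0 (negPf (cos_neq0 _)) => /eqP.
(* Letters [nu] are removed in pairs, down to none (the pure [e] word) or one (the impedance
   condition). *)
have H a b : (a + b = m.+1)%N -> W (nseq a nu ++ nseq b e) = 0.
  elim/ltn_ind: a b => -[|[|a]] IH b ab.
  - by have -> : b = m.+1 by lia.
  - have -> : b = m by lia.
    by apply: (Wnu m); apply: low; rewrite size_nseq.
  - rewrite /= Wtrace_free ?size_cat ?size_nseq; last by lia.
    have -> : W [:: e, e & nseq a nu ++ nseq b e]
              = W (nseq a nu ++ nseq b.+2 e) by perm.
    by rewrite IH ?oppr0 //; lia.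
(* Arbitrary letters are expanded in the basis one by one, the blocks collecting those already
   expanded. *)
suff G t a b : (size t + a + b = m.+1)%N ->
    W (t ++ nseq a nu ++ nseq b e) = 0.
  move=> sm; have := G s 0 0; rewrite /= cats0 !addn0; exact.
elim: t a b => [|v t IH] a b; first exact: H.
move=> sz; have [c [d ->]] := basis v; rewrite /= Wlin.
have -> : W (e :: t ++ nseq a nu ++ nseq b e)
          = W (t ++ nseq a nu ++ nseq b.+1 e) by perm.
have -> : W (nu :: t ++ nseq a nu ++ nseq b e)
          = W (t ++ nseq a.+1 nu ++ nseq b e) by perm.
by move: sz => /= sz; rewrite (IH a b.+1) ?(IH a.+1 b) ?scaler0 ?addr0 //; lia.
Qed.

End degree.

(** Strong induction on the length supplies the vanishing of shorter words; the empty word is the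
    nodal condition at the corner. *)
Lemma words_eq0 s : W s = 0.
Proof.
have [n sn] := ubnP (size s); elim: n s sn => // n IH s sn.
case sm : (size s) => [|m]; first by rewrite (size0nil sm); exact: (Wep 0).
apply: (words_degree_eq0 m) => // t tm; apply: IH; lia.
Qed.

End harmonic_words.

(** * Vanishing of all derivatives of [u] at the corner [x0] *)

Theorem theorem4p2 (R : realType) (Omega : set (R * R)) (lambda : R)
    (u : R * R -> R * R) (x0 : R * R) (h : R) (em ep : R * R) (alpha : R)
    (C1 : R * R) :
  open Omega -> 0 < lambda ->
  smooth_on Omega u -> L2_on Omega u ->
  (forall x, Omega x -> - laplacian u x = lambda *: u x) ->
  Omega x0 -> 0 < h ->
  unit_vec em -> 0 < alpha -> alpha < 2 -> ~ rational alpha ->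
  ep = rotv (alpha * pi)%R em ->
  segment x0 em h `<=` Omega -> segment x0 ep h `<=` Omega ->
  (* Gamma^- is a generalized singular line with constant parameter C1 <> 0;
     the unit normal nu is em rotated by pi/2 *)
  C1 != 0 ->
  (forall x, segment x0 em h x ->
     'D_(rotv (pi / 2)%R em) u x + cmul C1 (u x) = 0) ->
  (* Gamma^+ is a nodal line *)
  (forall x, segment x0 ep h x -> u x = 0) ->
  Vani_infinite u x0.
Proof.
move=> Oopen _ su _ helmholtz Ox0 h0 unit_e a0 _ alpha_irr epE eO epO _ impedance nodal.
pose nu := rotv (pi / 2) em.
have nuE : nu = (- em.2, em.1).
  by rewrite /nu /rotv cos_pihalf sin_pihalf !mul0r !mul1r sub0r addr0.
have at0 e : x0 = x0 + 0 *: e by rewrite scale0r addr0.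
have h00 : 0 <= (0 : R) < h. by rewrite lexx h0.
suff W0 s : derive_word u s x0 = 0.
  move=> n y; rewrite /taylor_hom big1 // => k _.
  by rewrite pderiv_word W0 scaler0.
apply: (@words_eq0 R _ (fun s => derive_word u s x0) _ _ em nu ep (alpha * pi) lambda).
- by move=> s1 s2 s12; exact: (derive_word_perm Omega).
- by move=> a b v w t; apply: (derive_lin Omega) => //; exact: smooth_word.
- move=> t.
  have emE : em = (em.1, em.2) by case: (em).
  have st := smooth_word Omega Oopen u t su.
  have lapE := laplacian_rot Omega Oopen _ _ _ st unit_e x0 Ox0.
  rewrite nuE {1 2}emE; apply: (etrans lapE).
  exact: (helmholtz_word Omega).
- move=> v; exists (v.1 * em.1 + v.2 * em.2), (v.2 * em.1 - v.1 * em.2).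
  by rewrite nuE; exact: orthonormal_coordinates.
- by rewrite epE nuE /rotv; congr (_, _); rewrite /= /GRing.scale /=; ring.
- by move=> n; exact: cos_irrational.
(* The nodal condition is read as [u + 0 * u = 0] and its derivatives are taken at [t = 0]. *)
- move=> n.
  have cmul0 (z : R * R) : cmul 0 z = 0 by rewrite /cmul /= !mul0r subr0 addr0.
  have := @derive_word_ray R Omega Oopen u u 0 x0 ep h n su su epO _ 0 h00.
  rewrite cmul0 addr0 -at0; apply.
  by move=> x /nodal ux; rewrite cmul0 addr0.
(* Differentiating the impedance condition along [em] leaves [nu] as the innermost letter; a
   permutation brings it to the front. *)
- move=> n un0.
  have := @derive_word_ray R Omega Oopen ('D_nu u) u C1 x0 em h n
    (smooth_derive _ Oopen _ _ su) su eO impedance 0 h00.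
  rewrite -at0 un0 /cmul /= !mulr0 subr0 !addr0.
  rewrite -[derive_word ('D_nu u) _]/(derive_word (derive_word u [:: nu]) _).
  rewrite -derive_word_cat cats1.
  move=> word0; apply: etrans word0.
  have nu_last : perm_eq (nu :: nseq n em) (rcons (nseq n em) nu).
    by rewrite perm_sym perm_rcons.
  exact: (derive_word_perm Omega Oopen u _ _ su nu_last x0 Ox0).
Qed.
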